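(* Let $A\in\mathbb R^{n\times n}$ be symmetric positive definite, let $0\le\delta<\lambda_{\min}(A)$, and set $$a_*=\lambda_{\min}(A)-\delta,\quad b_*=\lambda_{\max}(A)+\delta,\quad \widehat\kappa=b_*/a_*,\quad q_*=\frac{\sqrt{\widehat\kappa}-1}{\sqrt{\widehat\kappa}+1}.$$ Suppose that the (floating-point) CG and direct Lanczos recurrences described in the context admit exact enlarged Lanczos models $\widehat A_{\rm cg}$ and $\widehat A_{\rm lan}$ (symmetric matrices) whose spectra lie in $[a_*,b_*]$; the models reproduce the respective tridiagonal coefficients and the next coupling coefficient through $k$ steps. For CG, the tridiagonal coefficients are the Jacobi coefficients recovered in exact arithmetic from the positive stored coefficients $a_j^{\rm cg}$ and $b_{j+1}^{\rm cg}$ by $$\overline\alpha_1=1/a_0^{\rm cg},\qquad \overline\alpha_j=1/a_{j-1}^{\rm cg}+b_{j-1}^{\rm cg}/a_{j-2}^{\rm cg}\ (2\le j\le k),\qquad \overline\beta_{j+1}=\sqrt{b_j^{\rm cg}}/a_{j-1}^{\rm cg}\ (1\le j\le k).$$ For $\ell\in\{{\rm cg},{\rm lan}\}$, let $\widehat r_j^\ell$ be the exact CG residual on $\widehat A_\ell$, starting from zero with a nonzero multiple of its first Lanczos vector as right-hand side. With the convention $q_*^0=1$, for $0\le j\le k$, $$\frac{\|\widehat r_j^\ell\|_{\widehat A_\ell^{-1}}}{\|\widehat r_0^\ell\|_{\widehat A_\ell^{-1}}}\le2q_*^j,\qquad \frac{\|\widehat r_j^\ell\|_2}{\|\widehat r_0^\ell\|_2}\le2\sqrt{\widehat\kappa}\,q_*^j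 .$$ For the stored CG residuals $r_j$, assume that each squared norm is reused or identically reevaluated in the same order in the coefficient ratios, with relative error at most $\gamma_n<1$, and that the divisions have relative error at most $u<1$. Then, before a zero residual or a zero divisor, $$\frac{\|r_j\|_2}{\|r_0\|_2}\le\sqrt{\frac{1+\gamma_n}{1-\gamma_n}}\,(1-u)^{-j/2}\,\frac{\|\widehat r_j^{\rm cg}\|_2}{\|\widehat r_0^{\rm cg}\|_2}.$$ For direct Lanczos, write $r_0^{\rm true}=b-Ax_0$ and suppose $AV_j=V_jT_j+\beta_{j+1}v_{j+1}e_j^T+F_j$. For $\beta_1>0$, if $T_jy_j=\beta_1e_1$ is solved exactly and $x_j=x_0+V_jy_j$, then $$b-Ax_j=(r_0^{\rm true}-\beta_1v_1)-\beta_{j+1}(e_j^Ty_j)v_{j+1}-F_jy_j .$$ With $\|\widehat r_0^{\rm lan}\|_2=\beta_1$, this gives $$\|b-Ax_j\|_2\le\|r_0^{\rm true}-\beta_1v_1\|_2+\|v_{j+1}\|_2\|\widehat r_j^{\rm lan}\|_2+\|F_jy_j\|_2 .$$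
   Context: An exact enlarged Lanczos model through $k$ steps is a symmetric matrix (of possibly larger order than $A$) together with a unit starting vector such that the exact-arithmetic symmetric Lanczos process on it produces the given diagonal coefficients (first $k$) and off-diagonal coefficients (numbered $2,\dots,k+1$). $\|x\|_{B}=(x^TBx)^{1/2}$ for positive definite $B$. $u$ is the unit roundoff and $\gamma_n=nu/(1-nu)$. $e_i$ is the $i$th coordinate vector of $\mathbb R^j$. Stored CG recurrence (each operation rounded, $\operatorname{fl}$): $r_0=\operatorname{fl}(b-Ax_0)$, $p_0=r_0$, $$q_j=\operatorname{fl}(Ap_j),\ a_j^{\rm cg}=\operatorname{fl}\!\left(\tfrac{\operatorname{fl}(\langle r_j,r_j\rangle)}{\operatorname{fl}(\langle q_j,p_j\rangle)}\right),\ x_{j+1}=\operatorname{fl}(x_j+a_j^{\rm cg}p_j),\ r_{j+1}=\operatorname{fl}(r_j-a_j^{\rm cg}q_j),$$ $$b_{j+1}^{\rm cg}=\operatorname{fl}\!\left(\tfrac{\operatorname{fl}(\langle r_{j+1},r_{j+1}\rangle)}{\operatorname{fl}(\langle r_j,r_j\rangle)}\right),\ p_{j+1}=\operatorname{fl}(r_{j+1}+b_{j+1}^{\rm cg}p_j).$$ Stored Lanczos recurrence: $r_0=\operatorname{fl}(b-Ax_0)$, $v_0=0$, $\beta_1=\operatorname{fl}(\sqrt{\operatorname{fl}(\langle r_0,r_0\rangle)})$, $v_1=\operatorname{fl}(r_0/\beta_1)$, and for $j\ge1$: $q_j=\operatorname{fl}(Av_j)$, $w_j=\operatorname{fl}(q_j-\beta_jv_{j-1})$,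 $\alpha_j=\operatorname{fl}(\langle v_j,w_j\rangle)$, $z_j=\operatorname{fl}(w_j-\alpha_jv_j)$, $\beta_{j+1}=\operatorname{fl}(\sqrt{\operatorname{fl}(\langle z_j,z_j\rangle)})$, $v_{j+1}=\operatorname{fl}(z_j/\beta_{j+1})$. $V_j=[v_1,\dots,v_j]$, and $T_j$ is the symmetric tridiagonal matrix with diagonal $\alpha_1,\dots,\alpha_j$ and off-diagonal $\beta_2,\dots,\beta_j$. For direct Lanczos the tridiagonal coefficients to be reproduced by $\widehat A_{\rm lan}$ are these $\alpha_j,\beta_{j+1}$. *)

(* Defs.v *)
From mathcomp Require Import all_boot all_order all_algebra.
From mathcomp Require Import classical_sets reals.

Set Implicit Arguments.
Unset Strict Implicit.
Unset Printing Implicit Defensive.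

Import Order.TTheory GRing.Theory Num.Theory.
Local Open Scope ring_scope.

Section LinearAlgebra.
Variables (R : realType) (n : nat).
Implicit Types (A B : 'M[R]_n) (x y : 'cV[R]_n).

Definition dot x y : R := (x^T *m y) 0 0.

(* Matrix norms in MathComp-Analysis are sup norms, hence these definitions. *)
Definition norm2 x : R := Num.sqrt (dot x x).

Definition norm_in B x : R := Num.sqrt ((x^T *m B *m x) 0 0).

Definition sym_posdef A : Prop :=
  A^T = A /\ forall x, x != 0 -> 0 < (x^T *m A *m x) 0 0.

Definition lambda_min A : R := inf [set a | eigenvalue A a]%classic.

Definition lambda_max A : R := sup [set a | eigenvalue A a]%classic.

Definition spectrum_in (lo hi : R) A : Prop :=
  forall a, eigenvalue A a -> lo <= a <= hi.

End LinearAlgebra.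

Definition rel_err (R : realType) (eps computed exact : R) : Prop :=
  `|computed - exact| <= eps * `|exact|.

Definition gamma (R : realType) (n : nat) (u : R) : R :=
  n%:R * u / (1 - n%:R * u).

(* The places at which the two recurrences evaluate an inner product.  A squared
   residual norm is needed three times, and these three evaluations are kept
   apart so that "reused or identically reevaluated" is a real hypothesis. *)
Inductive dot_call : Type :=
| RRa of nat      (* <r_j, r_j> as the numerator of a_j *)
| QPa of nat      (* <q_j, p_j> as the denominator of a_j *)
| RRnum of nat    (* <r_j, r_j> as the numerator of b_j *)
| RRden of nat    (* <r_j, r_j> as the denominator of b_(j+1) *)
| ZZbeta of nat   (* the squared norm under the root in beta_j *)
| VWalpha of nat. (* <v_j, w_j> in alpha_j *)

(* The operations fl(.) of the recurrences.  They are not constrained at all, so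
   any format, rounding mode, summation order (which may change from one call to
   the next), fused or unfused update is an instance; accuracy is only assumed
   where it is stated explicitly. *)
Record arith (R : realType) (n : nat) : Type := Arith {
  fl_res  : 'M[R]_n -> 'cV[R]_n -> 'cV[R]_n -> 'cV[R]_n;  (* A b x: fl(b - A x) *)
  fl_mv   : nat -> 'M[R]_n -> 'cV[R]_n -> 'cV[R]_n;       (* step A p: fl(A p) *)
  fl_dot  : dot_call -> 'cV[R]_n -> 'cV[R]_n -> R;        (* fl(<x, y>) *)
  fl_addm : 'cV[R]_n -> R -> 'cV[R]_n -> 'cV[R]_n;        (* x a y: fl(x + a y) *)
  fl_subm : 'cV[R]_n -> R -> 'cV[R]_n -> 'cV[R]_n;        (* x a y: fl(x - a y) *)
  fl_vdiv : 'cV[R]_n -> R -> 'cV[R]_n;                    (* x a: fl(x / a) *)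
  fl_div  : R -> R -> R;
  fl_sqrt : R -> R }.

Definition exact_arith (R : realType) (n : nat) : arith R n := {|
  fl_res := fun A b x => b - A *m x;
  fl_mv := fun _ A p => A *m p;
  fl_dot := fun _ x y => dot x y;
  fl_addm := fun x a y => x + a *: y;
  fl_subm := fun x a y => x - a *: y;
  fl_vdiv := fun x a => a^-1 *: x;
  fl_div := fun x y => x / y;
  fl_sqrt := fun x => Num.sqrt x |}.

Section CG.
Variables (R : realType) (n : nat) (K : arith R n).
Variables (A : 'M[R]_n) (b x0 : 'cV[R]_n).

Record cg_state : Type :=
  CGState { st_x : 'cV[R]_n; st_r : 'cV[R]_n; st_p : 'cV[R]_n }.

Definition cg_a_of (j : nat) (s : cg_state) : R :=
  fl_div K (fl_dot K (RRa j) (st_r s) (st_r s))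
           (fl_dot K (QPa j) (fl_mv K j A (st_p s)) (st_p s)).

(* b_(j+1), from the residuals r = r_j and r' = r_(j+1). *)
Definition cg_b_of (j : nat) (r r' : 'cV[R]_n) : R :=
  fl_div K (fl_dot K (RRnum j.+1) r' r') (fl_dot K (RRden j) r r).

Definition cg_next (j : nat) (s : cg_state) : cg_state :=
  let q := fl_mv K j A (st_p s) in
  let a := cg_a_of j s in
  let r' := fl_subm K (st_r s) a q in
  CGState (fl_addm K (st_x s) a (st_p s)) r'
          (fl_addm K r' (cg_b_of j (st_r s) r') (st_p s)).

Fixpoint cg_iter (j : nat) : cg_state :=
  if j is i.+1 then cg_next i (cg_iter i)
  else CGState x0 (fl_res K A b x0) (fl_res K A b x0).

Definition cg_r (j : nat) : 'cV[R]_n := st_r (cg_iter j).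
Definition cg_p (j : nat) : 'cV[R]_n := st_p (cg_iter j).
Definition cg_q (j : nat) : 'cV[R]_n := fl_mv K j A (cg_p j).
Definition cg_a (j : nat) : R := cg_a_of j (cg_iter j).

(* Meaningful for j >= 1. *)
Definition cg_b (j : nat) : R :=
  if j is i.+1 then cg_b_of i (cg_r i) (cg_r i.+1) else 0.

Definition cg_no_breakdown (j : nat) : Prop :=
  (forall i, (i <= j)%N -> cg_r i != 0) /\
  (forall i, (i < j)%N ->
     fl_dot K (RRden i) (cg_r i) (cg_r i) != 0 /\
     fl_dot K (QPa i) (cg_q i) (cg_p i) != 0).

(* Through step j, every coefficient ratio uses the one stored value rho i of
   the squared norm of r_i. *)
Definition cg_sqnorm_reused (rho : nat -> R) (j : nat) : Prop :=
  forall i, (i < j)%N ->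
    [/\ fl_dot K (RRa i) (cg_r i) (cg_r i) = rho i,
        fl_dot K (RRden i) (cg_r i) (cg_r i) = rho i &
        fl_dot K (RRnum i.+1) (cg_r i.+1) (cg_r i.+1) = rho i.+1].

Definition cg_sqnorm_accurate (eps : R) (rho : nat -> R) (j : nat) : Prop :=
  forall i, (i <= j)%N -> rel_err eps (rho i) (dot (cg_r i) (cg_r i)).

Definition cg_div_accurate (eps : R) (j : nat) : Prop :=
  forall i, (i < j)%N ->
    rel_err eps (cg_a i)
      (fl_dot K (RRa i) (cg_r i) (cg_r i) /
       fl_dot K (QPa i) (cg_q i) (cg_p i)) /\
    rel_err eps (cg_b i.+1)
      (fl_dot K (RRnum i.+1) (cg_r i.+1) (cg_r i.+1) /
       fl_dot K (RRden i) (cg_r i) (cg_r i)).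

End CG.

(* As x / 0 = 0, the residual stays 0 once it has vanished. *)
Definition exact_cg_residual (R : realType) (N : nat) (A : 'M[R]_N)
    (b : 'cV[R]_N) (j : nat) : 'cV[R]_N :=
  cg_r (exact_arith R N) A b 0 j.

(* Jacobi coefficients carried by CG coefficients; meaningful for j >= 1. *)
Definition jacobi_alpha (R : realType) (a b : nat -> R) (j : nat) : R :=
  if j is i.+2 then 1 / a i.+1 + b i.+1 / a i else 1 / a 0.

(* Meaningful for j >= 2. *)
Definition jacobi_beta (R : realType) (a b : nat -> R) (j : nat) : R :=
  if j is i.+2 then Num.sqrt (b i.+1) / a i else 0.

Section Lanczos.
Variables (R : realType) (n : nat) (K : arith R n).
Variables (A : 'M[R]_n) (b x0 : 'cV[R]_n).

(* The triple (v_(j-1), beta_j, v_j). *)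
Record lan_state : Type :=
  LanState { st_vprev : 'cV[R]_n; st_beta : R; st_v : 'cV[R]_n }.

Definition lan_w_of (j : nat) (s : lan_state) : 'cV[R]_n :=
  fl_subm K (fl_mv K j A (st_v s)) (st_beta s) (st_vprev s).

Definition lan_alpha_of (j : nat) (s : lan_state) : R :=
  fl_dot K (VWalpha j) (st_v s) (lan_w_of j s).

Definition lan_normalize (j : nat) (vprev z : 'cV[R]_n) : lan_state :=
  let beta := fl_sqrt K (fl_dot K (ZZbeta j) z z) in
  LanState vprev beta (fl_vdiv K z beta).

Definition lan_next (j : nat) (s : lan_state) : lan_state :=
  lan_normalize j.+1 (st_v s)
    (fl_subm K (lan_w_of j s) (lan_alpha_of j s) (st_v s)).

(* lan_iter i holds (v_i, beta_(i+1), v_(i+1)). *)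
Fixpoint lan_iter (i : nat) : lan_state :=
  if i is i'.+1 then lan_next i (lan_iter i')
  else lan_normalize 1 0 (fl_res K A b x0).

Definition lan_v (j : nat) : 'cV[R]_n :=
  if j is i.+1 then st_v (lan_iter i) else 0.

(* Both meaningful for j >= 1. *)
Definition lan_beta (j : nat) : R := st_beta (lan_iter j.-1).
Definition lan_alpha (j : nat) : R := lan_alpha_of j (lan_iter j.-1).

(* Column l (from 0) of V_j is v_(l+1). *)
Definition lan_V (j : nat) : 'M[R]_(n, j) :=
  \matrix_(i < n, l < j) lan_v l.+1 i 0.

Definition lan_T (j : nat) : 'M[R]_j :=
  \matrix_(i < j, l < j)
    if (i == l :> nat) then lan_alpha i.+1
    else if (l == i.+1 :> nat) then lan_beta l.+1
    else if (i == l.+1 :> nat) then lan_beta i.+1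
    else 0.

End Lanczos.

(* The exact process on (Ahat, v) is the Lanczos recurrence in exact arithmetic
   with right-hand side v and initial guess 0: then beta_1 = 1 and v_1 = v.
   "Produces the coefficients through k steps" includes that it does not stop
   earlier; only the last coupling beta_(k+1) may be 0. *)
Definition lanczos_model (R : realType) (k N : nat) (Ahat : 'M[R]_N)
    (v : 'cV[R]_N) (alpha beta : nat -> R) : Prop :=
  [/\ Ahat^T = Ahat,
      norm2 v = 1,
      forall j, (1 <= j <= k)%N ->
        lan_alpha (exact_arith R N) Ahat v 0 j = alpha j,
      forall j, (2 <= j <= k.+1)%N ->
        lan_beta (exact_arith R N) Ahat v 0 j = beta j &
      forall j, (2 <= j <= k)%N ->
        lan_beta (exact_arith R N) Ahat v 0 j != 0].

Inductive method : Type := Cg | Lan.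

Definition tridiag_alpha (R : realType) (n : nat) (K : arith R n)
    (A : 'M[R]_n) (b x0 : 'cV[R]_n) (l : method) : nat -> R :=
  match l with
  | Cg => jacobi_alpha (cg_a K A b x0) (cg_b K A b x0)
  | Lan => lan_alpha K A b x0
  end.

Definition tridiag_beta (R : realType) (n : nat) (K : arith R n)
    (A : 'M[R]_n) (b x0 : 'cV[R]_n) (l : method) : nat -> R :=
  match l with
  | Cg => jacobi_beta (cg_a K A b x0) (cg_b K A b x0)
  | Lan => lan_beta K A b x0
  end.

(* Main.v *)
Require Import Defs.
From mathcomp Require Import all_boot all_order all_algebra.
From mathcomp Require Import classical_sets reals.
From mathcomp Require Import complex.
From mathcomp Require Import ring lra zify.

(* A polynomial that is nonnegative on the spectrum of a symmetric M has a
   nonnegative quadratic form, so every spectral estimate becomes an inequality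
   between polynomials.  Exact CG residuals are orthogonal to the Krylov spaces,
   hence minimal in the norm of the inverse of M among residual polynomials, and
   the scaled Chebyshev polynomial gives the rate; passing to the 2-norm costs
   the square root of the condition number.

   Eliminating the search directions from exact CG shows that its normalized
   residuals are, up to sign, the Lanczos vectors and that its coefficients
   determine the Lanczos coefficients by the Jacobi formulas.  These formulas are
   invertible, so the stored CG coefficients are the exact CG coefficients of the
   model, and the product of the stored b_i is the squared ratio of the model
   residual norms; for the stored residuals the same product telescopes up to the
   assumed errors.

   For Lanczos, the solution of the projected system yields a residual that is
   orthogonal to the Krylov space, so it coincides with the exact CG residual of
   the model; its norm is |beta_(j+1) (y_j)_j|. *)

Set Implicit Arguments.
Unset Strict Implicit.
Unset Printing Implicit Defensive.

Import Order.TTheory GRing.Theory Num.Theory.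
Local Open Scope ring_scope.

(** * Quadratic forms of polynomials in a symmetric matrix *)

(** [eigenvalue] refers to row vectors, and the rows of the diagonalizing matrix [P] are left
    eigenvectors, nonzero since [P] is invertible. *)
Lemma eigenvalue_spectral_diag (C : numClosedFieldType) n (M : 'M[C]_n) i :
  M \is normalmx -> eigenvalue M (spectral_diag M 0 i).
Proof.
move=> /orthomx_spectralP ME; set P := spectralmx M in ME.
have Pu : P \in unitmx by exact: spectral_unit.
apply/eigenvalueP; exists (row i P).
  rewrite -row_mul [X in P *m X]ME !mulmxA mulmxV // mul1mx.
  by rewrite row_mul row_diag_mx -scalemxAl -rowE.
apply/eqP => /(congr1 (mulmx^~ (invmx P))) /=.
rewrite rowE mulmxK // mul0mx => /rowP/(_ i)/eqP.
by rewrite !mxE !eqxx oner_eq0.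
Qed.

(** Over the complex extension [M] is unitarily diagonalizable, so the form becomes a sum of terms
    [p.[d_i] * |z_i|^2], where [z] is [x] in the eigenbasis. *)
Lemma horner_mx_form_ge0 (R : rcfType) n (M : 'M[R]_n.+1) (p : {poly R})
    (x : 'cV[R]_n.+1) :
  M^T = M -> (forall a, eigenvalue M a -> 0 <= p.[a]) ->
  0 <= (x^T *m horner_mx M p *m x) 0 0.
Proof.
move=> Msym p_ge0; pose f := real_complex R; pose MC := map_mx f M.
have MCherm : MC \is hermsymmx.
  apply: realsym_hermsym.
    by apply/is_hermitianmxP; rewrite expr0 scale1r map_mx_id // /MC map_trmx Msym.
  by apply/mxOverP=> i j; rewrite !mxE; apply/complex_realP; exists (M i j).
have MCnorm := hermitian_normalmx MCherm.
have /orthomx_spectralP MCE := MCnorm.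
have Pun := spectral_unitarymx MC.
set P := spectralmx MC in MCE Pun; set d := spectral_diag MC in MCE.
rewrite -(ler0c (_ 0 0)).
have -> : ((x^T *m horner_mx M p *m x) 0 0)%:C%C =
  (map_mx f (x^T *m horner_mx M p *m x)) 0 0 by rewrite [RHS]mxE.
rewrite !map_mxM map_horner_mx -/MC MCE horner_mx_uconjC ?spectral_unit //.
rewrite horner_mx_diag invmx_unitary //.
set y := map_mx f x.
have -> : map_mx f x^T = map_mx Num.conj y^T.
  apply/matrixP=> i j; rewrite !mxE; apply/esym/CrealP/complex_realP.
  by eexists.
rewrite !mulmxA -map_mxM -trmx_mul -!mulmxA mxE; apply: sumr_ge0 => i _.
rewrite mul_diag_mx !mxE mulrCA -normCKC mulr_ge0 ?exprn_ge0 //.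
(* The [d_i] are real because [MC] is Hermitian; comparing characteristic polynomials makes them
   eigenvalues of [M] itself. *)
have [a da] : exists a, d 0 i = f a.
  by apply/complex_realP/(mxOverP (hermitian_spectral_diag_real MCherm)).
rewrite da horner_map ler0c; apply: p_ge0.
have := eigenvalue_spectral_diag i MCnorm.
by rewrite !eigenvalue_root_char -map_char_poly -/d da fmorph_root.
Qed.

(** * Chebyshev polynomials *)

Section Chebyshev.
Variables (R : rcfType) (a b : R).

Let L : {poly R} := (a + b)%:P - 2 *: 'X.
Let E : {poly R} := L ^+ 2 - ((b - a) ^+ 2)%:P.

(* The pair [(S, U)] of coefficients of [(L + sqrt E) ^+ j = S + U * sqrt E];
   [S] is the shifted and scaled Chebyshev polynomial
   [(b - a) ^+ j * T_j (L / (b - a))], and needs no [a != b]. *)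
Fixpoint cheb (j : nat) : {poly R} * {poly R} :=
  if j is i.+1 then (L * (cheb i).1 + E * (cheb i).2, L * (cheb i).2 + (cheb i).1)
  else (1, 0).

Let size_L : (size L <= 2)%N.
Proof.
rewrite (leq_trans (size_polyD _ _)) // geq_max size_polyN.
rewrite (leq_trans (size_polyC_leq1 _)) //.
by rewrite (leq_trans (size_scale_leq _ _)) // size_polyX.
Qed.

Let size_E : (size E <= 3)%N.
Proof.
rewrite (leq_trans (size_polyD _ _)) // geq_max size_polyN.
rewrite (leq_trans (size_polyC_leq1 _)) // andbT.
by rewrite expr2 (leq_trans (size_polyMleq _ _)) //; have := size_L; lia.
Qed.

Lemma size_cheb j : (size (cheb j).1 <= j.+1)%N /\ (size (cheb j).2 <= j)%N.
Proof.
elim: j => [|j [IS IU]] /=; first by rewrite size_poly1 size_poly0.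
have sM (p q : {poly R}) := size_polyMleq p q.
have [sL sE] := (size_L, size_E).
split; rewrite (leq_trans (size_polyD _ _)) // geq_max; apply/andP; split.
- by rewrite (leq_trans (sM _ _)) //; lia.
- by rewrite (leq_trans (sM _ _)) //; lia.
- by rewrite (leq_trans (sM _ _)) //; lia.
- by [].
Qed.

Lemma horner_cheb1S j x :
  (cheb j.+1).1.[x] = L.[x] * (cheb j).1.[x] + E.[x] * (cheb j).2.[x].
Proof. by rewrite /= hornerD !hornerM. Qed.

Lemma horner_cheb2S j x :
  (cheb j.+1).2.[x] = L.[x] * (cheb j).2.[x] + (cheb j).1.[x].
Proof. by rewrite /= hornerD hornerM. Qed.

(** Multiplicativity of the norm [S ^+ 2 - E * U ^+ 2] of [S + U * sqrt E], whose value at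
    [L + sqrt E] is [L ^+ 2 - E = (b - a) ^+ 2]. *)
Lemma cheb_pell j x :
  (cheb j).1.[x] ^+ 2 - E.[x] * (cheb j).2.[x] ^+ 2 = (b - a) ^+ j ^+ 2.
Proof.
have EE : E.[x] = L.[x] ^+ 2 - (b - a) ^+ 2 by rewrite !hornerE.
elim: j => [|j IH]; first by rewrite hornerC horner0; ring.
rewrite (exprS (b - a)) exprMn -IH horner_cheb1S horner_cheb2S EE; ring.
Qed.

(** On [[a, b]], [E = - 4 * (x - a) * (b - x)] is nonpositive, so the Pell identity bounds the
    square of [S]. *)
Lemma cheb_bound j x : a <= x <= b -> `|(cheb j).1.[x]| <= (b - a) ^+ j.
Proof.
move=> /andP[ax xb]; have ab : 0 <= b - a by lra.
rewrite -(@ler_pXn2r _ 2) ?nnegrE ?exprn_ge0 // real_normK ?num_real //.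
rewrite -(cheb_pell j x) lerDl -mulNr mulr_ge0 ?sqr_ge0 //.
rewrite /E /L !hornerE.
have -> : - ((a + b - 2 * x) ^+ 2 - (b - a) ^+ 2) = 4 * ((x - a) * (b - x)) by ring.
by rewrite !mulr_ge0 // subr_ge0.
Qed.

Lemma cheb_at0 j : 0 <= a -> 0 <= b ->
  (cheb j).1.[0] = ((Num.sqrt b + Num.sqrt a) ^+ j ^+ 2
                    + (Num.sqrt b - Num.sqrt a) ^+ j ^+ 2) / 2.
Proof.
move=> a0 b0; set s := Num.sqrt a; set t := Num.sqrt b.
have aE : a = s ^+ 2 by rewrite sqr_sqrtr.
have bE : b = t ^+ 2 by rewrite sqr_sqrtr.
have LE : L.[0] = s ^+ 2 + t ^+ 2 by rewrite /L !hornerE aE bE; ring.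
have EE : E.[0] = (2 * s * t) ^+ 2.
  have -> : E.[0] = L.[0] ^+ 2 - (b - a) ^+ 2 by rewrite !hornerE.
  by rewrite LE aE bE; ring.
(* At 0, [L + e * sqrt E] is the square of [t + e * s] for both signs [e]; averaging the two [j]-th
   powers isolates [S]. *)
suff H e : e ^+ 2 = 1 -> (cheb j).1.[0] + e * (2 * s * t) * (cheb j).2.[0] =
   (t + e * s) ^+ j ^+ 2.
  have := H 1 (expr1n _ _); have := H (-1) (etrans (sqrrN 1) (expr1n _ _)).
  rewrite !mulN1r !mul1r mulNr => H1 H2; lra.
move=> e1; elim: j => [|j IH]; first by rewrite hornerC horner0; ring.
rewrite (exprS (t + e * s)) [in RHS]exprMn -IH horner_cheb1S horner_cheb2S EE LE.
have -> : (t + e * s) ^+ 2 = t ^+ 2 + s ^+ 2 + e * (2 * s * t).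
  by rewrite sqrrD exprMn e1; ring.
rewrite [in RHS]mulrDl ![in RHS]mulrDr.
have -> : e * (2 * s * t) * (e * (2 * s * t) * (cheb j).2.[0]) =
  (2 * s * t) ^+ 2 * (cheb j).2.[0] by rewrite -[RHS]mul1r -e1; ring.
ring.
Qed.

(** The witness is [S] rescaled to value 1 at 0. With [s], [t] the roots of [a], [b], [S] is at most
    [(t - s) ^+ j * (t + s) ^+ j] on the interval and at least [(t + s) ^+ j ^+ 2 / 2] at 0. *)
Lemma minimax_poly j : 0 < a -> a <= b ->
  let q := (Num.sqrt (b / a) - 1) / (Num.sqrt (b / a) + 1) in
  exists p : {poly R}, [/\ (size p <= j.+1)%N, p.[0] = 1 &
    forall x, a <= x <= b -> `|p.[x]| <= 2 * q ^+ j].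
Proof.
move=> a0 ab q; set s := Num.sqrt a; set t := Num.sqrt b.
have b0 : 0 < b by lra.
have s0 : 0 < s by rewrite sqrtr_gt0.
have t0 : 0 < t by rewrite sqrtr_gt0.
have qE : q = (t - s) / (t + s).
  rewrite /q sqrtrM ?(ltW b0) // sqrtrV ?(ltW a0) // -/s -/t.
  by field; rewrite !gt_eqF ?addr_gt0 //.
have S0 := cheb_at0 j (ltW a0) (ltW b0); rewrite -/s -/t in S0.
have S0ge : (t + s) ^+ j ^+ 2 / 2 <= (cheb j).1.[0].
  by rewrite S0 ler_pM2r ?invr_gt0 // lerDl sqr_ge0.
have ts0 : 0 < (t + s) ^+ j by rewrite exprn_gt0 // addr_gt0.
have S0gt : 0 < (cheb j).1.[0].
  by apply: lt_le_trans S0ge; rewrite divr_gt0 // exprn_gt0.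
exists ((cheb j).1.[0]^-1 *: (cheb j).1); split.
- by rewrite (leq_trans (size_scale_leq _ _)) //; case: (size_cheb j).
- by rewrite hornerZ mulVf // gt_eqF.
move=> x xab; rewrite hornerZ normrM gtr0_norm ?invr_gt0 // mulrC ler_pdivrMr //.
apply: le_trans (cheb_bound j xab) _.
have bE : b - a = (t - s) * (t + s).
  by rewrite -subr_sqr !sqr_sqrtr ?ltW.
have ts : s <= t by rewrite ler_wsqrtr.
rewrite bE exprMn qE expr_div_n.
have -> : (t - s) ^+ j * (t + s) ^+ j =
  2 * ((t - s) ^+ j / (t + s) ^+ j) * ((t + s) ^+ j ^+ 2 / 2).
  by field; rewrite gt_eqF.
rewrite ler_wpM2l // mulr_ge0 // divr_ge0 ?exprn_ge0 ?subr_ge0 //.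
by rewrite addr_ge0 ?ltW.
Qed.

End Chebyshev.

(** * Inner product and Euclidean norm *)

Section DotProduct.
Variables (R : realType) (n : nat).
Implicit Types (x y z : 'cV[R]_n) (a : R) (M : 'M[R]_n).

Lemma dotE x y : dot x y = \sum_i x i 0 * y i 0.
Proof. by rewrite /dot mxE; apply: eq_bigr => i _; rewrite mxE. Qed.

Lemma dotC x y : dot x y = dot y x.
Proof. by rewrite !dotE; apply: eq_bigr => i _; rewrite mulrC. Qed.

Lemma dotDr x y z : dot x (y + z) = dot x y + dot x z.
Proof. by rewrite /dot mulmxDr mxE. Qed.

Lemma dotZr x a y : dot x (a *: y) = a * dot x y.
Proof. by rewrite /dot -scalemxAr mxE. Qed.

Lemma dotNr x y : dot x (- y) = - dot x y.
Proof. by rewrite -scaleN1r dotZr mulN1r. Qed.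

Lemma dotBr x y z : dot x (y - z) = dot x y - dot x z.
Proof. by rewrite dotDr dotNr. Qed.

Lemma dotDl x y z : dot (x + y) z = dot x z + dot y z.
Proof. by rewrite ![dot _ z]dotC dotDr. Qed.

Lemma dotZl x a y : dot (a *: x) y = a * dot x y.
Proof. by rewrite ![dot _ y]dotC dotZr. Qed.

Lemma dotBl x y z : dot (x - y) z = dot x z - dot y z.
Proof. by rewrite ![dot _ z]dotC dotBr. Qed.

Lemma dot0r x : dot x 0 = 0.
Proof. by rewrite -(scale0r 0) dotZr mul0r. Qed.

Lemma dot0l x : dot 0 x = 0.
Proof. by rewrite dotC dot0r. Qed.

Lemma dot_ge0 x : 0 <= dot x x.
Proof. by rewrite dotE; apply: sumr_ge0 => i _; rewrite -expr2 sqr_ge0. Qed.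

Lemma dot_eq0 x : (dot x x == 0) = (x == 0).
Proof.
apply/eqP/eqP => [|->]; last by rewrite dot0r.
rewrite dotE => /psumr_eq0P x0; apply/colP => i; apply/eqP.
by rewrite mxE -sqrf_eq0 expr2 x0 // => j _; rewrite -expr2 sqr_ge0.
Qed.

Lemma dot_gt0 x : (0 < dot x x) = (x != 0).
Proof. by rewrite lt0r dot_eq0 dot_ge0 andbT. Qed.

Lemma dot_mulmx M x y : M^T = M -> dot (M *m x) y = dot x (M *m y).
Proof. by move=> MT; rewrite /dot trmx_mul MT mulmxA. Qed.

Lemma sqr_norm2 x : norm2 x ^+ 2 = dot x x.
Proof. by rewrite sqr_sqrtr // dot_ge0. Qed.

Lemma norm2_ge0 x : 0 <= norm2 x.
Proof. exact: sqrtr_ge0. Qed.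

Lemma norm2_eq0 x : (norm2 x == 0) = (x == 0).
Proof. by rewrite -sqrf_eq0 sqr_norm2 dot_eq0. Qed.

Lemma norm2_gt0 x : (0 < norm2 x) = (x != 0).
Proof. by rewrite lt0r norm2_eq0 norm2_ge0 andbT. Qed.

Lemma norm2Z a x : norm2 (a *: x) = `|a| * norm2 x.
Proof.
by rewrite /norm2 dotZl dotZr mulrA -expr2 sqrtrM ?sqr_ge0 // sqrtr_sqr.
Qed.

Lemma norm2N x : norm2 (- x) = norm2 x.
Proof. by rewrite -scaleN1r norm2Z normrN1 mul1r. Qed.

(** Cauchy-Schwarz, from expanding the squared norm of [norm2 y *: x - norm2 x *: y]. *)
Lemma dot_le_norm2 x y : dot x y <= norm2 x * norm2 y.
Proof.
have [->|x0] := eqVneq x 0; first by rewrite dot0l mulr_ge0 ?norm2_ge0.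
have [->|y0] := eqVneq y 0; first by rewrite dot0r mulr_ge0 ?norm2_ge0.
have xy0 : 0 < norm2 x * norm2 y by rewrite mulr_gt0 ?norm2_gt0.
have := dot_ge0 (norm2 y *: x - norm2 x *: y).
rewrite dotBl !dotBr !(dotZl, dotZr) -!sqr_norm2 (dotC y x) => h.
rewrite -(ler_pM2l xy0); lra.
Qed.

Lemma norm2D x y : norm2 (x + y) <= norm2 x + norm2 y.
Proof.
rewrite -(@ler_pXn2r _ 2) ?nnegrE ?addr_ge0 ?norm2_ge0 //.
rewrite sqr_norm2 dotDl !dotDr -!sqr_norm2 (dotC y x).
have := dot_le_norm2 x y; rewrite sqrrD => h; lra.
Qed.

Lemma norm2B x y : norm2 (x - y) <= norm2 x + norm2 y.
Proof. by rewrite -[X in _ <= _ + X]norm2N norm2D. Qed.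

End DotProduct.

(** * Conjugate gradients in exact arithmetic *)

Section Krylov.
Variables (R : realType) (n : nat) (M : 'M[R]_n.+1) (b : 'cV[R]_n.+1).

Lemma horner_mulmxZ a (g : {poly R}) :
  horner_mx M (a *: g) *m b = a *: (horner_mx M g *m b).
Proof. by rewrite linearZ; exact/esym/scalemxAl. Qed.

Lemma horner_mulmxD (g h : {poly R}) :
  horner_mx M (g + h) *m b = horner_mx M g *m b + horner_mx M h *m b.
Proof. by rewrite rmorphD; exact: mulmxDl. Qed.

Lemma horner_mulmxB (g h : {poly R}) :
  horner_mx M (g - h) *m b = horner_mx M g *m b - horner_mx M h *m b.
Proof. by rewrite rmorphB; exact: mulmxBl. Qed.

Lemma horner_mulmxX (g : {poly R}) :
  horner_mx M ('X * g) *m b = M *m (horner_mx M g *m b).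
Proof. by rewrite rmorphM /= horner_mx_X -mulmxE mulmxA. Qed.

Lemma horner_mulmxC (g : {poly R}) :
  horner_mx M g *m (M *m b) = M *m (horner_mx M g *m b).
Proof. by rewrite -horner_mulmxX mulrC rmorphM /= horner_mx_X -mulmxE mulmxA. Qed.

(** Membership is witnessed by a polynomial of degree below [j], not by a span, so that leading
    coefficients can be compared. *)
Definition krylov (j : nat) (y : 'cV[R]_n.+1) : Prop :=
  exists2 g : {poly R}, (size g <= j)%N & y = horner_mx M g *m b.

Lemma krylov0 j : krylov j 0.
Proof. by exists 0; rewrite ?size_poly0 // rmorph0 mul0mx. Qed.

Lemma krylovD j y z : krylov j y -> krylov j z -> krylov j (y + z).
Proof.
move=> [g sg ->] [h sh ->]; exists (g + h); last by rewrite horner_mulmxD.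
by rewrite (leq_trans (size_polyD _ _)) // geq_max sg sh.
Qed.

Lemma krylovZ j a y : krylov j y -> krylov j (a *: y).
Proof.
move=> [g sg ->]; exists (a *: g); last by rewrite horner_mulmxZ.
by rewrite (leq_trans (size_scale_leq _ _)).
Qed.

Lemma krylovB j y z : krylov j y -> krylov j z -> krylov j (y - z).
Proof. by move=> ky kz; rewrite -scaleN1r; apply/krylovD/krylovZ. Qed.

Lemma krylov_leq i j y : (i <= j)%N -> krylov i y -> krylov j y.
Proof. by move=> ij [g sg ->]; exists g => //; apply: leq_trans ij. Qed.

Lemma krylov_mulmx j y : krylov j y -> krylov j.+1 (M *m y).
Proof.
move=> [g sg ->]; exists ('X * g); last by rewrite horner_mulmxX.
rewrite (leq_trans (size_polyMleq _ _)) // size_polyX; lia.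
Qed.

Lemma krylov_start : krylov 1 b.
Proof. by exists 1; rewrite ?size_poly1 // rmorph1 mul1mx. Qed.

(* A Krylov vector whose polynomial has the full degree [j] completes the
   [j]-th Krylov space to the next one. *)
Lemma krylovS j (g : {poly R}) y : size g = j.+1 -> krylov j.+1 y ->
  exists a, krylov j (y - a *: (horner_mx M g *m b)).
Proof.
move=> sg [h sh ->]; exists (h`_j / lead_coef g), (h - (h`_j / lead_coef g) *: g).
  apply/leq_sizeP => i; rewrite leq_eqVlt => /predU1P[<-|ji].
    rewrite coefB coefZ /lead_coef sg /= divfK ?subrr //.
    have : lead_coef g != 0 by rewrite lead_coef_eq0 -size_poly_eq0 sg.
    by rewrite /lead_coef sg.
  have hi : h`_i = 0 by rewrite nth_default // (leq_trans sh).
  have gi : g`_i = 0 by rewrite nth_default // sg.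
  by rewrite coefB coefZ hi gi mulr0 subr0.
by rewrite horner_mulmxB horner_mulmxZ.
Qed.

End Krylov.

(** * Orthogonality relations of exact CG *)

Section ExactCG.
Variables (R : realType) (n : nat) (M : 'M[R]_n.+1) (b : 'cV[R]_n.+1).
Hypothesis Msym : M^T = M.
Hypothesis Mpos : forall x, x != 0 -> 0 < dot (M *m x) x.

Let r := cg_r (exact_arith R n.+1) M b 0.
Let p := cg_p (exact_arith R n.+1) M b 0.
Let a := cg_a (exact_arith R n.+1) M b 0.
Let be := cg_b (exact_arith R n.+1) M b 0.

Lemma exact_cg_r0 : r 0 = b.
Proof. by rewrite /r /cg_r /= mulmx0 subr0. Qed.

Lemma exact_cg_p0 : p 0 = b.
Proof. by rewrite /p /cg_p /= mulmx0 subr0. Qed.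

Lemma exact_cg_aE j : a j = dot (r j) (r j) / dot (M *m p j) (p j).
Proof. by []. Qed.

Lemma exact_cg_bE j : be j.+1 = dot (r j.+1) (r j.+1) / dot (r j) (r j).
Proof. by []. Qed.

Lemma exact_cg_rS j : r j.+1 = r j - a j *: (M *m p j).
Proof. by []. Qed.

Lemma exact_cg_pS j : p j.+1 = r j.+1 + be j.+1 *: p j.
Proof. by []. Qed.

Lemma exact_cg_r_stays0 j : r j = 0 -> r j.+1 = 0.
Proof. by move=> rj; rewrite exact_cg_rS exact_cg_aE rj dot0r mul0r scale0r subr0. Qed.

Lemma exact_cg_r_neq0 i j : (i <= j)%N -> r j != 0 -> r i != 0.
Proof.
move=> /subnK <-; elim: (j - i)%N => // d IH rd; apply: IH.
by apply: contra_neq rd => /exact_cg_r_stays0.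
Qed.

Lemma krylov_exact_cg j : krylov M b j.+1 (r j) /\ krylov M b j.+1 (p j).
Proof.
elim: j => [|j [IHr IHp]].
  by rewrite exact_cg_r0 exact_cg_p0; split; exact: krylov_start.
have kr : krylov M b j.+2 (r j.+1).
  rewrite exact_cg_rS; apply: krylovB; first exact: krylov_leq IHr.
  exact/krylovZ/krylov_mulmx.
split=> //; rewrite exact_cg_pS; apply: krylovD => //.
by apply: krylovZ; exact: krylov_leq IHp.
Qed.

Lemma exact_cg_rB j : exists2 z, krylov M b j z & b - r j = M *m z.
Proof.
elim: j => [|j [z kz zE]].
  by exists 0; [exact: krylov0 | rewrite exact_cg_r0 subrr mulmx0].
(* The witness follows the update of the CG iterate, which starts from zero. *)
exists (z + a j *: p j).
  apply: krylovD; first exact: krylov_leq kz.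
  by apply/krylovZ; case: (krylov_exact_cg j).
by rewrite exact_cg_rS opprB addrCA zE mulmxDr -scalemxAr addrC.
Qed.

(** Besides orthogonality of the residual and conjugacy of the direction, the first identity ensures
    that [p j] is nonzero when [r j] is. *)
Let cg_invariant (j : nat) : Prop :=
  [/\ dot (r j) (p j) = dot (r j) (r j),
      forall y, krylov M b j y -> dot (r j) y = 0 &
      forall y, krylov M b j y -> dot (M *m p j) y = 0].

Lemma cg_invariant_a_gt0 j : cg_invariant j -> r j != 0 -> 0 < a j.
Proof.
move=> [rp _ _] rj; rewrite exact_cg_aE divr_gt0 ?dot_gt0 // Mpos //.
by apply: contraTneq rj => pj; rewrite -dot_eq0 -rp pj dot0r eqxx.
Qed.

(** The polynomial of [p j] has exact degree [j], so [p j] completes one Krylov space to the next,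
    and orthogonality need only be tested on the smaller space and on [p j]. *)
Lemma cg_invariantP j : (forall i, (i < j)%N -> r i != 0) -> 
  cg_invariant j /\
  exists gr gp : {poly R}, [/\ size gr = j.+1, r j = horner_mx M gr *m b,
    size gp = j.+1 & p j = horner_mx M gp *m b].
Proof.
elim: j => [|j IH] r_neq0.
  split; last first.
    exists 1, 1; rewrite exact_cg_r0 exact_cg_p0 rmorph1 mul1mx size_poly1.
    by split.
  have k0 y : krylov M b 0 y -> y = 0.
    by case=> g; rewrite leqn0 size_poly_eq0 => /eqP -> ->; rewrite rmorph0 mul0mx.
  split; first by rewrite exact_cg_r0 exact_cg_p0.
    by move=> y /k0 ->; rewrite dot0r.
  by move=> y /k0 ->; rewrite dot0r.
have [|inv [gr [gp [sr rE sp pE]]]] := IH.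
  by move=> i ij; apply: r_neq0; exact: ltnW.
have rj : r j != 0 by exact: r_neq0.
have aj := cg_invariant_a_gt0 inv rj.
case: inv => rp rK pK.
have rr0 : dot (r j) (r j) != 0 by rewrite dot_eq0.
have pp0 : dot (M *m p j) (p j) != 0.
  by rewrite gt_eqF // Mpos //; apply: contraTneq rj => pj;
     rewrite -dot_eq0 -rp pj dot0r eqxx.
have r1p : dot (r j.+1) (p j) = 0.
  by rewrite exact_cg_rS dotBl dotZl rp exact_cg_aE divfK ?subrr.
have r1K y : krylov M b j.+1 y -> dot (r j.+1) y = 0.
  move=> /(krylovS sp) [c]; rewrite -pE => ky.
  rewrite -(subrK (c *: p j) y) dotDr dotZr r1p mulr0 addr0.
  by rewrite exact_cg_rS dotBl dotZl rK // pK // mulr0 subr0.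
split.
  split=> //.
    by rewrite exact_cg_pS dotDr dotZr r1p mulr0 addr0.
  move=> y /(krylovS sp) [c]; rewrite -pE; set y' := y - _ => ky.
  rewrite -(subrK (c *: p j) y) -/y' dotDr dotZr.
  rewrite exact_cg_pS mulmxDr -scalemxAr !dotDl !dotZl (pK _ ky) mulr0 addr0.
  rewrite (dot_mulmx _ _ Msym) r1K; last exact: krylov_mulmx.
  rewrite add0r (dot_mulmx _ _ Msym).
  (* Once [M *m p j] is a difference of residuals, the value of [be j.+1] is exactly the one that
     makes [p j.+1] conjugate to [p j]. *)
  have Mp : M *m p j = (a j)^-1 *: (r j - r j.+1).
    by rewrite exact_cg_rS opprB addrC subrK scalerA mulVf ?gt_eqF // scale1r.
  rewrite [X in dot _ X]Mp dotZr dotBr r1K; last by case: (krylov_exact_cg j).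
  rewrite exact_cg_bE exact_cg_aE; field.
  by rewrite rr0 pp0.
(* As [a j] is nonzero, this term raises the degree by exactly one and dominates the others. *)
have sXg : size (a j *: ('X * gp)) = j.+2.
  by rewrite size_scale ?gt_eqF // mulrC size_mulX ?sp // -size_poly_eq0 sp.
exists (gr - a j *: ('X * gp)), (gr - a j *: ('X * gp) + be j.+1 *: gp).
have s1 : size (gr - a j *: ('X * gp)) = j.+2.
  by rewrite addrC size_polyDl size_polyN sXg // sr.
have rE1 : r j.+1 = horner_mx M (gr - a j *: ('X * gp)) *m b.
  by rewrite exact_cg_rS rE pE horner_mulmxB horner_mulmxZ horner_mulmxX.
split=> //.
  rewrite size_polyDl s1 // (leq_ltn_trans (size_scale_leq _ _)) // sp //.
by rewrite exact_cg_pS rE1 pE [RHS]horner_mulmxD horner_mulmxZ.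
Qed.

Lemma exact_cg_r_orth j y : krylov M b j y -> dot (r j) y = 0.
Proof.
have [->|rj] := eqVneq (r j) 0; first by rewrite dot0l.
have [|[_ h _] _] := @cg_invariantP j; last exact: h.
by move=> i ij; apply: exact_cg_r_neq0 rj; exact: ltnW.
Qed.

Lemma exact_cg_a_gt0 j : r j != 0 -> 0 < a j.
Proof.
move=> rj; apply: cg_invariant_a_gt0 => //; case: (@cg_invariantP j) => // i ij.
by apply: exact_cg_r_neq0 rj; exact: ltnW.
Qed.

(* The CG residual is the Galerkin residual of the Krylov space. *)
Lemma exact_cg_r_uniq j y z : krylov M b j z -> b - y = M *m z ->
  (forall w, krylov M b j w -> dot y w = 0) -> y = r j.
Proof.
move=> kz yE yK; have [w kw rE] := exact_cg_rB j.
(* Two Galerkin residuals differ by [M *m e] with [e] in the Krylov space, to which both are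
   orthogonal; positivity then forces [e = 0]. *)
have dE : r j - y = M *m (z - w) by rewrite mulmxBr -yE -rE opprB [RHS]addrC addrA subrK.
have kd : krylov M b j (z - w) by exact: krylovB.
have [d0|/Mpos] := eqVneq (z - w) 0.
  by apply/eqP; rewrite eq_sym -subr_eq0 dE d0 mulmx0.
by rewrite -dE dotBl exact_cg_r_orth // yK // subrr ltxx.
Qed.

End ExactCG.

(** * Convergence rate of exact CG *)

Section Convergence.
Variables (R : realType) (n : nat) (M : 'M[R]_n.+1) (lo hi : R).
Hypothesis Msym : M^T = M.
Hypothesis Mspec : spectrum_in lo hi M.
Hypothesis lo_gt0 : 0 < lo.

Lemma dot_horner_mx_ge0 (p : {poly R}) x :
  (forall a, lo <= a <= hi -> 0 <= p.[a]) -> 0 <= dot x (horner_mx M p *m x).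
Proof.
move=> p0; rewrite /dot mulmxA; apply: horner_mx_form_ge0 => // a /Mspec.
exact: p0.
Qed.

(** If [hi < lo], even the constant -1 is nonnegative on the empty interval, while its form is
    negative at the all-ones vector. *)
Lemma spectrum_in_le : lo <= hi.
Proof.
rewrite leNgt; apply/negP => hilo.
have : 0 <= dot (const_mx 1) (horner_mx M (-1) *m const_mx 1).
  apply: dot_horner_mx_ge0 => a /andP[la ah].
  by have := le_lt_trans (le_trans la ah) hilo; rewrite ltxx.
rewrite rmorphN1 mulNmx mul1mx dotNr oppr_ge0 leNgt dot_gt0 => /negP; apply.
by apply/eqP => /colP/(_ 0)/eqP; rewrite !mxE oner_eq0.
Qed.

Lemma dot_mulmx_ge x : lo * dot x x <= dot (M *m x) x.
Proof.
have : 0 <= dot x (horner_mx M ('X - lo%:P) *m x).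
  by apply: dot_horner_mx_ge0 => a /andP[la _]; rewrite !hornerE subr_ge0.
rewrite horner_mulmxB horner_mx_X horner_mx_C mul_scalar_mx dotBr dotZr subr_ge0.
by rewrite -dot_mulmx.
Qed.

Lemma dot_mulmx_gt0 x : x != 0 -> 0 < dot (M *m x) x.
Proof.
by move=> x0; apply: lt_le_trans (dot_mulmx_ge x); rewrite mulr_gt0 ?dot_gt0.
Qed.

Lemma unitmx_spectrum_gt0 : M \in unitmx.
Proof.
rewrite unitmxE unitfE; apply/negP => /det0P [v v0 vM].
have : eigenvalue M 0 by apply/eigenvalueP; exists v; rewrite ?scale0r.
by move=> /Mspec /andP[]; rewrite leNgt lo_gt0.
Qed.

Lemma dot_horner_mx (p : {poly R}) x y :
  dot (horner_mx M p *m x) y = dot x (horner_mx M p *m y).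
Proof.
elim/poly_ind: p x y => [|p c IH] x y; first by rewrite rmorph0 !mul0mx dot0l dot0r.
rewrite !horner_mulmxD mulrC !horner_mulmxX horner_mx_C !mul_scalar_mx.
by rewrite dotDl dotDr dotZl dotZr dot_mulmx // IH horner_mulmxC.
Qed.

Lemma sqr_norm_in_invmx x : norm_in (invmx M) x ^+ 2 = dot x (invmx M *m x).
Proof.
have -> : dot x (invmx M *m x) = (x^T *m invmx M *m x) 0 0.
  by rewrite /dot mulmxA.
rewrite sqr_sqrtr // -mulmxA; set y := invmx M *m x.
have -> : x = M *m y by rewrite mulKVmx // unitmx_spectrum_gt0.
apply: le_trans (dot_mulmx_ge y); rewrite mulr_ge0 ?dot_ge0 //; exact: ltW.
Qed.

Lemma sqr_norm_in_invmx_mulmx y : norm_in (invmx M) (M *m y) ^+ 2 = dot (M *m y) y.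
Proof. by rewrite sqr_norm_in_invmx mulKmx // unitmx_spectrum_gt0. Qed.

Lemma norm_in_invmx_ge0 x : 0 <= norm_in (invmx M) x.
Proof. exact: sqrtr_ge0. Qed.

(** With [x = M *m y], the difference of the two sides is the form of ['X * ('X - lo)] at [y]; the
    upper bound below uses ['X * (hi - 'X)]. *)
Lemma sqr_norm_in_invmx_le x : lo * norm_in (invmx M) x ^+ 2 <= norm2 x ^+ 2.
Proof.
have -> : x = M *m (invmx M *m x) by rewrite mulKVmx // unitmx_spectrum_gt0.
set y := invmx M *m x; rewrite sqr_norm_in_invmx_mulmx sqr_norm2.
have : 0 <= dot y (horner_mx M ('X * ('X - lo%:P)) *m y).
  apply: dot_horner_mx_ge0 => a /andP[la _]; rewrite !hornerE mulr_ge0 ?subr_ge0 //.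
  exact: le_trans (ltW lo_gt0) la.
rewrite horner_mulmxX -dot_mulmx // horner_mulmxB horner_mx_X horner_mx_C.
by rewrite mul_scalar_mx dotBr dotZr subr_ge0.
Qed.

Lemma sqr_norm2_le x : norm2 x ^+ 2 <= hi * norm_in (invmx M) x ^+ 2.
Proof.
have -> : x = M *m (invmx M *m x) by rewrite mulKVmx // unitmx_spectrum_gt0.
set y := invmx M *m x; rewrite sqr_norm_in_invmx_mulmx sqr_norm2.
have : 0 <= dot y (horner_mx M ('X * (hi%:P - 'X)) *m y).
  apply: dot_horner_mx_ge0 => a /andP[la ah]; rewrite !hornerE mulr_ge0 ?subr_ge0 //.
  exact: le_trans (ltW lo_gt0) la.
rewrite horner_mulmxX -dot_mulmx // horner_mulmxB horner_mx_X horner_mx_C.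
by rewrite mul_scalar_mx dotBr dotZr subr_ge0.
Qed.

Let q := (Num.sqrt (hi / lo) - 1) / (Num.sqrt (hi / lo) + 1).

Lemma sqrt_cond_ge1 : 1 <= Num.sqrt (hi / lo).
Proof.
by rewrite -[leLHS]sqrtr1 ler_wsqrtr // ler_pdivlMr // mul1r spectrum_in_le.
Qed.

Lemma cg_rate_ge0 : 0 <= q.
Proof. by have := sqrt_cond_ge1; rewrite /q => h; apply: divr_ge0; lra. Qed.

(** With [x = M *m y], the difference of the squares is the form of ['X * (c ^+ 2 - p * p)] at
    [y]. *)
Lemma norm_in_horner_mx_le (p : {poly R}) (c : R) x : 0 <= c ->
  (forall a, lo <= a <= hi -> `|p.[a]| <= c) ->
  norm_in (invmx M) (horner_mx M p *m x) <= c * norm_in (invmx M) x.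
Proof.
move=> c0 pc.
rewrite -(@ler_pXn2r _ 2) ?nnegrE ?mulr_ge0 ?norm_in_invmx_ge0 // exprMn.
have -> : x = M *m (invmx M *m x) by rewrite mulKVmx // unitmx_spectrum_gt0.
set y := invmx M *m x.
rewrite horner_mulmxC !sqr_norm_in_invmx_mulmx.
have : 0 <= dot y (horner_mx M ('X * ((c ^+ 2)%:P - p * p)) *m y).
  apply: dot_horner_mx_ge0 => a /[dup] /pc pa /andP[la _].
  rewrite !hornerE mulr_ge0 //; first exact: le_trans (ltW lo_gt0) la.
  by rewrite subr_ge0 -expr2 -real_normK ?num_real // ler_pXn2r ?nnegrE.
rewrite horner_mulmxX -dot_mulmx // horner_mulmxB horner_mx_C mul_scalar_mx.
rewrite dotBr dotZr subr_ge0; apply: le_trans.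
rewrite -horner_mulmxC.
by rewrite dot_horner_mx rmorphM /= -mulmxE mulmxA.
Qed.

Variable b : 'cV[R]_n.+1.
Let r := exact_cg_residual M b.

(* Galerkin orthogonality makes the CG residual minimal in the norm of [invmx M]
   among the residual polynomials. *)
Lemma exact_cg_r_optimal j (p : {poly R}) : (size p <= j.+1)%N -> p.[0] = 1 ->
  norm_in (invmx M) (r j) <= norm_in (invmx M) (horner_mx M p *m b).
Proof.
(* Writing [p = 1 + 'X * g] shows that [p(M) b] and [r j] differ by [M] applied to a Krylov
   vector. *)
move=> sp p0; have /factor_theorem[g gE] : root (p - 1) 0.
  by rewrite /root hornerD hornerN p0 hornerC subrr.
have sg : (size g <= j)%N.
  have [->|g0] := eqVneq g 0; first by rewrite size_poly0.
  have := congr1 (fun s : {poly R} => size s) gE.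
  rewrite /= subr0 size_mulX // => sE; rewrite -ltnS -sE.
  by rewrite (leq_trans (size_polyD _ _)) // geq_max sp size_polyN size_poly1.
have [z kz zE] : exists2 z, krylov M b j z & b - r j = M *m z.
  exact: exact_cg_rB.
have kgz : krylov M b j (horner_mx M g *m b + z).
  by apply: krylovD => //; exists g.
set y := horner_mx M g *m b + z in kgz.
have pE : horner_mx M p *m b = r j + M *m y.
  rewrite -(subrK 1 p) gE subr0 mulrC horner_mulmxD horner_mulmxX rmorph1 mul1mx.
  by rewrite mulmxDr -zE addrCA; congr (_ + _); rewrite addrC subrK.
move: y => y in kgz pE *.
rewrite -(@ler_pXn2r _ 2) ?nnegrE ?norm_in_invmx_ge0 // !sqr_norm_in_invmx pE.
(* The cross terms vanish by orthogonality, which leaves the nonnegative surplus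
   [dot (M *m y) y]. *)
have ryE : dot (r j) y = 0 by apply: exact_cg_r_orth => //; exact: dot_mulmx_gt0.
rewrite mulmxDr mulKmx ?unitmx_spectrum_gt0 // dotDl !dotDr ryE addr0.
rewrite dot_mulmx // mulKVmx ?unitmx_spectrum_gt0 // (dotC y) ryE add0r lerDl.
apply: le_trans (dot_mulmx_ge y); rewrite mulr_ge0 ?dot_ge0 //; exact: ltW.
Qed.

Lemma exact_cg_norm_in_le j :
  norm_in (invmx M) (r j) <= 2 * q ^+ j * norm_in (invmx M) (r 0).
Proof.
have [p [sp p0 pB]] := minimax_poly j lo_gt0 spectrum_in_le.
have -> : r 0 = b by exact: exact_cg_r0.
apply: le_trans (exact_cg_r_optimal sp p0) _.
apply: norm_in_horner_mx_le => //.
by rewrite mulr_ge0 ?exprn_ge0 ?cg_rate_ge0.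
Qed.

Lemma exact_cg_convergence j : b != 0 ->
  norm_in (invmx M) (r j) / norm_in (invmx M) (r 0) <= 2 * q ^+ j /\
  norm2 (r j) / norm2 (r 0) <= 2 * Num.sqrt (hi / lo) * q ^+ j.
Proof.
have r0E : r 0 = b by exact: exact_cg_r0.
move=> b0; have rj := exact_cg_norm_in_le j.
have n0 : 0 < norm2 b by rewrite norm2_gt0.
have hi_gt0 : 0 < hi := lt_le_trans lo_gt0 spectrum_in_le.
have := sqr_norm_in_invmx_le b; have := sqr_norm2_le b.
have := sqr_norm2_le (r j); move: rj; rewrite r0E.
have := norm_in_invmx_ge0 b; have := norm_in_invmx_ge0 (r j).
set xj := norm_in _ (r j); set x := norm_in _ b => xj0 x0 rj hj h0 l0.
have xgt0 : 0 < x.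
  rewrite lt0r x0 andbT; apply: contraTneq h0 => ->.
  by rewrite expr0n mulr0 -ltNge exprn_gt0.
split; first by rewrite ler_pdivrMr.
have qj : 0 <= 2 * q ^+ j by rewrite mulr_ge0 ?exprn_ge0 ?cg_rate_ge0.
rewrite ler_pdivrMr // -(@ler_pXn2r _ 2) ?nnegrE ?mulr_ge0 ?norm2_ge0 ?sqrtr_ge0 //;
  last by rewrite exprn_ge0 ?cg_rate_ge0.
apply: le_trans hj _.
(* Changing norms costs [hi] at [r j] and [1 / lo] at [b]; together they give the condition
   number. *)
have -> : (2 * Num.sqrt (hi / lo) * q ^+ j * norm2 b) ^+ 2 =
    hi * ((2 * q ^+ j) ^+ 2 * (norm2 b ^+ 2 / lo)).
  have := sqr_sqrtr (divr_ge0 (ltW hi_gt0) (ltW lo_gt0)).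
  move=> sE; rewrite !exprMn sE; field; exact: lt0r_neq0.
rewrite ler_pM2l // (@le_trans _ _ ((2 * q ^+ j) ^+ 2 * x ^+ 2)) //.
  by rewrite -exprMn ler_pXn2r ?nnegrE //; exact: mulr_ge0.
by rewrite ler_wpM2l ?sqr_ge0 // ler_pdivlMr // mulrC.
Qed.

End Convergence.

(** * Lanczos in exact arithmetic *)

(** Column [l] of the product collects the indices [l], [l - 1] and [l + 1]. The second is absent
    for the first column, where [w 0 = 0]; the third is absent for the last, which produces the
    rank-one remainder. *)
Lemma three_term_mulmx (R : comNzRingType) (n m : nat) (M : 'M[R]_n)
    (w : nat -> 'cV[R]_n) (al be : nat -> R) :
  w 0 = 0 ->
  (forall i, M *m w i.+1 = be i.+1 *: w i + al i.+1 *: w i.+1 + be i.+2 *: w i.+2) ->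
  let V := \matrix_(i < n, l < m.+1) w l.+1 i 0 in
  let T := \matrix_(i < m.+1, l < m.+1)
    if (i == l :> nat) then al i.+1
    else if (l == i.+1 :> nat) then be l.+1
    else if (i == l.+1 :> nat) then be i.+1
    else 0 in
  M *m V = V *m T + be m.+2 *: (w m.+2 *m delta_mx 0 ord_max).
Proof.
move=> w0 wS V T; apply/matrixP => i l.
have -> : (M *m V) i l = (M *m w l.+1) i 0.
  by rewrite !mxE; apply: eq_bigr => t _; rewrite mxE.
rewrite wS !mxE big_ord1 !mxE eqxx /=.
have -> : \sum_t V i t * T t l =
    \sum_(t < m.+1 | t == l :> nat) w t.+1 i 0 * al t.+1
    + \sum_(t < m.+1 | l == t.+1 :> nat) w t.+1 i 0 * be l.+1
    + \sum_(t < m.+1 | t == l.+1 :> nat) w t.+1 i 0 * be t.+1.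
  rewrite [X in X + _ + _]big_mkcond [X in _ + X + _]big_mkcond.
  rewrite [X in _ + X]big_mkcond -!big_split /=; apply: eq_bigr => t _.
  rewrite !mxE.
  have [->|tl] := eqVneq (t : nat) l.
    by rewrite !ltn_eqF // !addr0.
  have [lt|lt] := eqVneq (l : nat) t.+1.
    by rewrite lt ltn_eqF // addr0 add0r.
  by rewrite !add0r; case: eqP; rewrite ?mulr0.
rewrite (big_ord1_eq _ (fun t => w t.+1 i 0 * al t.+1)) ltn_ord.
rewrite (big_ord1_eq _ (fun t => w t.+1 i 0 * be t.+1)) ltnS.
have -> : \sum_(t < m.+1 | l == t.+1 :> nat) w t.+1 i 0 * be l.+1 =
    be l.+1 * w l i 0.
  case: l => [[|l'] lm] /=; first by rewrite big_pred0_eq w0 mxE mulr0.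
  under eq_bigl => t do rewrite eqSS eq_sym.
  by rewrite (big_ord1_eq _ (fun t => w t.+1 i 0 * be l'.+2)) ltnW // mulrC.
rewrite [al _ * _]mulrC [_ + be l.+1 * _]addrC -!addrA; do 2 congr (_ + _).
have [lm|ml|/eqP lm] := ltngtP l m.
- by rewrite -val_eqE /= (ltn_eqF lm) !mulr0 addr0 mulrC.
- by have := ltn_ord l; rewrite ltnS leqNgt ml.
- by rewrite -val_eqE /= lm mulr1 add0r (eqP lm).
Qed.

Section ExactLanczos.
Variables (R : realType) (n : nat) (M : 'M[R]_n) (v : 'cV[R]_n).

Let lv := lan_v (exact_arith R n) M v 0.
Let la := lan_alpha (exact_arith R n) M v 0.
Let lb := lan_beta (exact_arith R n) M v 0.
Let lz i := M *m lv i.+1 - lb i.+1 *: lv i - la i.+1 *: lv i.+1.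

Let st_vprevE i : st_vprev (lan_iter (exact_arith R n) M v 0 i) = lv i.
Proof. by case: i. Qed.

Lemma exact_lan_alphaE i :
  la i.+1 = dot (lv i.+1) (M *m lv i.+1 - lb i.+1 *: lv i).
Proof. by rewrite -(st_vprevE i). Qed.

Lemma exact_lan_betaE i : lb i.+2 = norm2 (lz i).
Proof. by rewrite /lz -(st_vprevE i). Qed.

Lemma exact_lan_vE i : lv i.+2 = (lb i.+2)^-1 *: lz i.
Proof. by rewrite /lz -(st_vprevE i). Qed.

Lemma exact_lan_v1 : lv 1 = (norm2 v)^-1 *: v.
Proof. by rewrite /lv /lan_v /= mulmx0 subr0. Qed.

(** This survives a breakdown: the coupling is the norm of [lz i], so if it is 0 then so is
    [lz i]. *)
Lemma exact_lan_three_term i :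
  M *m lv i.+1 = lb i.+1 *: lv i + la i.+1 *: lv i.+1 + lb i.+2 *: lv i.+2.
Proof.
have -> : lb i.+2 *: lv i.+2 = lz i.
  rewrite exact_lan_vE; have [b0|b0] := eqVneq (lb i.+2) 0.
    rewrite b0 scale0r; apply/esym/eqP.
    by rewrite -norm2_eq0 -exact_lan_betaE b0.
  by rewrite scalerA mulfV // scale1r.
by rewrite /lz -[_ - _ - _]addrA -opprD [RHS]addrC subrK.
Qed.

Lemma exact_lan_relation m :
  M *m lan_V (exact_arith R n) M v 0 m.+1 =
  lan_V (exact_arith R n) M v 0 m.+1 *m lan_T (exact_arith R n) M v 0 m.+1
  + lb m.+2 *: (lv m.+2 *m delta_mx 0 ord_max).
Proof. by apply: three_term_mulmx; [| exact: exact_lan_three_term]. Qed.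

End ExactLanczos.

(** * Correspondence between exact CG and exact Lanczos *)

Section CGLanczos.
Variables (R : realType) (n : nat) (M : 'M[R]_n.+1) (v : 'cV[R]_n.+1) (c : R).
Hypothesis Msym : M^T = M.
Hypothesis Mpos : forall x, x != 0 -> 0 < dot (M *m x) x.
Hypothesis v1 : norm2 v = 1.
Hypothesis c0 : c != 0.

Let r := cg_r (exact_arith R n.+1) M (c *: v) 0.
Let p := cg_p (exact_arith R n.+1) M (c *: v) 0.
Let a := cg_a (exact_arith R n.+1) M (c *: v) 0.
Let be := cg_b (exact_arith R n.+1) M (c *: v) 0.
Let lv := lan_v (exact_arith R n.+1) M v 0.
Let la := lan_alpha (exact_arith R n.+1) M v 0.
Let lb := lan_beta (exact_arith R n.+1) M v 0.

Let nu i := norm2 (r i).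
(** The sign alternates because [r i.+1] enters [M *m r i] with a negative coefficient, whereas
    Lanczos couplings are norms. *)
Let sgn i : R := Num.sg c * (-1) ^+ i.
Let prev i := if i is i'.+1 then (be i / a i') *: r i' else 0.

Let sgnS i : sgn i.+1 = - sgn i.
Proof. by rewrite /sgn exprS mulrCA mulN1r. Qed.

Let sgn_sqr i : sgn i * sgn i = 1.
Proof. by rewrite -expr2 exprMn sqr_sg c0 -exprM mulnC exprM sqrrN !expr1n mul1r. Qed.

Let norm_sgn i : `|sgn i| = 1.
Proof. by rewrite normrM normr_sg c0 normrX normrN1 expr1n mul1r. Qed.

Let beE i : be i.+1 = nu i.+1 ^+ 2 / nu i ^+ 2.
Proof. by rewrite !sqr_norm2. Qed.

Let r_pred_neq0 i : r i.+1 != 0 -> r i != 0.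
Proof. exact: exact_cg_r_neq0. Qed.

Let a_gt0 i : r i != 0 -> 0 < a i.
Proof. exact: exact_cg_a_gt0. Qed.

(** Search directions are eliminated by [r i.+1 = p i.+1 - be i.+1 *: p i] and by writing each
    [M *m p j] as a multiple of [r j - r j.+1]. *)
Lemma exact_cg_three_term i : r i != 0 ->
  M *m r i = jacobi_alpha a be i.+1 *: r i - (a i)^-1 *: r i.+1 - prev i.
Proof.
have Mp j : r j != 0 -> M *m p j = (a j)^-1 *: (r j - r j.+1).
  move=> /a_gt0 aj.
  have -> : r j.+1 = r j - a j *: (M *m p j) by [].
  by rewrite opprB addrC subrK scalerA mulVf ?gt_eqF // scale1r.
case: i => [|i] ri /=.
  have -> : r 0 = p 0 by [].
  by rewrite Mp // subr0 div1r scalerBr.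
have rE : r i.+1 = p i.+1 - be i.+1 *: p i by rewrite [p i.+1]exact_cg_pS addrK.
rewrite [X in M *m X]rE mulmxBr -scalemxAr !Mp //; last exact: r_pred_neq0.
move: (r i) (r i.+1) (r i.+2) => x y z.
by rewrite div1r !scalerBr !scalerA !scalerDl opprB addrA (addrAC _ (- _)).
Qed.

Let orth i y : krylov M (c *: v) i y -> dot (r i) y = 0.
Proof. exact: exact_cg_r_orth. Qed.

Let krylov_r i : krylov M (c *: v) i.+1 (r i).
Proof. by case: (krylov_exact_cg M (c *: v) i). Qed.

Let orth_next i : dot (r i) (r i.+1) = 0.
Proof. rewrite dotC; apply: orth; exact: krylov_r. Qed.

Let laE i : la i.+1 = dot (lv i.+1) (M *m lv i.+1 - lb i.+1 *: lv i).
Proof. exact: exact_lan_alphaE. Qed.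

Let lbE i : lb i.+2 =
  norm2 (M *m lv i.+1 - lb i.+1 *: lv i - la i.+1 *: lv i.+1).
Proof. exact: exact_lan_betaE. Qed.

Let lvE i : lv i.+2 =
  (lb i.+2)^-1 *: (M *m lv i.+1 - lb i.+1 *: lv i - la i.+1 *: lv i.+1).
Proof. exact: exact_lan_vE. Qed.

Let jbE i : jacobi_beta a be i.+2 = Num.sqrt (be i.+1) / a i.
Proof. by []. Qed.

(** Orthogonality of consecutive residuals isolates the diagonal coefficient; the remainder is a
    multiple of [r i.+1], whose norm gives the coupling. *)
Let step i : r i != 0 -> lv i.+1 = (sgn i / nu i) *: r i ->
  lb i.+1 *: lv i = - (sgn i / nu i) *: prev i ->
  [/\ la i.+1 = jacobi_alpha a be i.+1,
      lb i.+2 = jacobi_beta a be i.+2 &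
      lv i.+2 = (sgn i.+1 / nu i.+1) *: r i.+1].
Proof.
move=> ri v1E v0E; have ai := a_gt0 ri.
have nui : 0 < nu i by rewrite norm2_gt0.
have wE : M *m lv i.+1 - lb i.+1 *: lv i =
    (sgn i / nu i) *: (jacobi_alpha a be i.+1 *: r i - (a i)^-1 *: r i.+1).
  rewrite v1E v0E -scalemxAr exact_cg_three_term // scaleNr opprK -scalerDr.
  by rewrite subrK.
have laE' : la i.+1 = jacobi_alpha a be i.+1.
  rewrite laE wE v1E dotZl dotZr dotBr !dotZr orth_next.
  rewrite mulr0 subr0 -sqr_norm2 -/(nu i).
  rewrite (_ : _ * _ = sgn i * sgn i * jacobi_alpha a be i.+1).
    by rewrite sgn_sqr mul1r.
  by field; rewrite gt_eqF.
have zE : M *m lv i.+1 - lb i.+1 *: lv i - la i.+1 *: lv i.+1 =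
    (sgn i.+1 / (nu i * a i)) *: r i.+1.
  rewrite wE laE' v1E sgnS; move: (r i) (r i.+1) => x y.
  rewrite scalerBr !scalerA [X in X *: x]mulrC addrAC subrr add0r -scaleNr.
  by congr (_ *: _); field; rewrite !gt_eqF.
have lbE2 : lb i.+2 = nu i.+1 / (nu i * a i).
  rewrite lbE zE norm2Z normrM norm_sgn mul1r.
  have na : 0 < nu i * a i by exact: mulr_gt0.
  by rewrite gtr0_norm ?invr_gt0 // [LHS]mulrC.
split=> //.
  rewrite lbE2 jbE beE sqrtrM ?sqr_ge0 // sqrtrV ?sqr_ge0 // !sqrtr_sqr.
  by rewrite !ger0_norm ?norm2_ge0 //; field; rewrite !gt_eqF.
rewrite lvE zE scalerA lbE2.
have [->|r1] := eqVneq (r i.+1) 0; first by rewrite !scaler0.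
have nu1 : 0 < nu i.+1 by rewrite norm2_gt0.
by congr (_ *: _); field; rewrite !gt_eqF.
Qed.

(** The range of [l] reaches one vector past [r i], which is 0 when CG terminates there. *)
Lemma exact_lan_cg i : r i != 0 ->
  [/\ la i.+1 = jacobi_alpha a be i.+1,
      lb i.+2 = jacobi_beta a be i.+2 &
      forall l, (l <= i.+1)%N -> lv l.+1 = (sgn l / nu l) *: r l].
Proof.
elim: i => [|i IH] ri.
  have lv1 : lv 1 = (sgn 0 / nu 0) *: r 0.
    rewrite /lv exact_lan_v1 v1 invr1 scale1r /nu /r exact_cg_r0 norm2Z v1 mulr1.
    by rewrite scalerA /sgn expr0 mulr1 mulrAC -normrEsg mulfV ?normr_eq0 // scale1r.
  have [|E1 E2 E3] := step ri lv1; first by rewrite /= !scaler0.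
  by split=> // -[|[|l]].
have ri' := r_pred_neq0 ri; have [E1 E2 E3] := IH ri'.
have nui : 0 < nu i by rewrite norm2_gt0.
have nui1 : 0 < nu i.+1 by rewrite norm2_gt0.
have ai := a_gt0 ri'.
have [||F1 F2 F3] := step ri; first exact: E3.
  rewrite E2 E3 // jbE /prev beE sqrtrM ?sqr_ge0 // sqrtrV ?sqr_ge0 // !sqrtr_sqr.
  rewrite !ger0_norm ?norm2_ge0 // !scalerA sgnS; congr (_ *: _); field.
  by rewrite !gt_eqF.
split=> // l; rewrite leq_eqVlt => /predU1P[->|]; first exact: F3.
by rewrite ltnS; exact: E3.
Qed.

(** By the Jacobi formula a vanishing [r i.+1] would make the coupling [lb i.+2] vanish. *)
Lemma exact_cg_r_neq0_lan k i :
  (forall j, (2 <= j <= k)%N -> lb j != 0) -> (i < k)%N -> r i != 0.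
Proof.
move=> lb0; elim: i => [|i IH] ik.
  by rewrite /r exact_cg_r0 scaler_eq0 (negPf c0) /= -norm2_eq0 v1 oner_eq0.
have [_ lbE' _] := exact_lan_cg (IH (ltnW ik)).
have := lb0 i.+2 ik; rewrite lbE' jbE beE; apply: contraNneq => r0.
have -> : nu i.+1 = 0 by apply/eqP; rewrite norm2_eq0 r0.
by rewrite expr0n mul0r sqrtr0 mul0r.
Qed.

(* The Galerkin residual lies in the Krylov space and is a multiple of the last
   Lanczos vector, so it is the CG residual. *)
Lemma exact_lan_residual m (y : 'cV[R]_m.+1) (be1 : R) : be1 != 0 -> r m != 0 ->
  lan_T (exact_arith R n.+1) M v 0 m.+1 *m y = be1 *: delta_mx ord0 0 ->
  norm2 (r m.+1) = `|c / be1| * `|lb m.+2 * y ord_max 0|.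
Proof.
move=> be1_neq0 rm Ty; have [_ _ lvr] := exact_lan_cg rm.
set V := lan_V (exact_arith R n.+1) M v 0 m.+1.
have kV : krylov M (c *: v) m.+1 (V *m y).
  have -> : V *m y = \sum_l y l 0 *: lv l.+1.
    apply/colP => i; rewrite !mxE summxE; apply: eq_bigr => l _.
    by rewrite [V]lock [RHS]mxE -lock mxE mulrC.
  apply: big_ind => [||l _]; [exact: krylov0|exact: krylovD|].
  rewrite lvr; last exact: ltnW.
  by apply/krylovZ/krylovZ; apply: krylov_leq (krylov_r l); exact: ltn_ord.
(* As [v] is the first column of [V], the projected system cancels all but the last coupling
   term. *)
have resE : c *: v - M *m ((c / be1) *: (V *m y)) =
   - (c / be1 * (lb m.+2 * y ord_max 0)) *: lv m.+2.
  have -> : v = be1^-1 *: (V *m (be1 *: delta_mx ord0 0)).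
    rewrite -scalemxAr scalerA mulVf // scale1r -colE.
    have -> : col ord0 V = lv 1 by apply/colP => i; rewrite !mxE.
    by rewrite /lv exact_lan_v1 v1 invr1 scale1r.
  rewrite -Ty -scalemxAr scalerA -scalerBr.
  have -> : M *m (V *m y) = V *m (lan_T (exact_arith R n.+1) M v 0 m.+1 *m y)
      + lb m.+2 *: (lv m.+2 *m delta_mx 0 ord_max) *m y.
    by rewrite mulmxA exact_lan_relation mulmxDl -mulmxA.
  rewrite opprD addrA subrr add0r -scalemxAl -mulmxA -rowE.
  rewrite [row ord_max y]mx11_scalar mxE mul_mx_scalar.
  move: (lv m.+2) (lb m.+2) => w t.
  by rewrite scalerN !scalerA scaleNr -mulrA.
have <- : - (c / be1 * (lb m.+2 * y ord_max 0)) *: lv m.+2 = r m.+1.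
  apply: (@exact_cg_r_uniq _ _ _ _ Msym Mpos _ _ ((c / be1) *: (V *m y))).
    exact: krylovZ kV.
    by rewrite -resE opprB addrC subrK.
  move=> w kw; rewrite lvr // !dotZl; have -> : dot (r m.+1) w = 0 by exact: orth.
  by rewrite !mulr0.
rewrite norm2Z normrN [X in X * _ = _]normrM.
have [->|lb0] := eqVneq (lb m.+2) 0; first by rewrite mul0r normr0 mulr0 mul0r.
suff -> : norm2 (lv m.+2) = 1 by rewrite mulr1.
by rewrite lvE norm2Z normfV -lbE ger0_norm ?mulVf // lbE norm2_ge0.
Qed.

End CGLanczos.

(** * Comparison of the recurrences with their models *)

(** The coefficients are recovered alternately: the first diagonal entry gives [a 0], the next
    coupling [b 1], the next diagonal entry [a 1], and so on. *)
Lemma jacobi_inj (R : realType) (a b a' b' : nat -> R) k :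
  (forall i, (i < k)%N -> 0 < a i) -> (forall i, (1 <= i <= k)%N -> 0 < b i) ->
  (forall i, (i < k)%N -> 0 < a' i) -> (forall i, 0 <= b' i) ->
  (forall j, (1 <= j <= k)%N -> jacobi_alpha a b j = jacobi_alpha a' b' j) ->
  (forall j, (2 <= j <= k.+1)%N -> jacobi_beta a b j = jacobi_beta a' b' j) ->
  forall i, (i < k)%N -> a i = a' i /\ b i.+1 = b' i.+1.
Proof.
move=> a0 b0 a'0 b'0 eqa eqb.
have eqb' i : (i < k)%N -> a i = a' i -> b i.+1 = b' i.+1.
  move=> ik aE; have := eqb i.+2 ik; rewrite /= aE => /divIf.
  rewrite gt_eqF ?a'0 // => /(_ isT) /(congr1 (fun x => x ^+ 2)).
  by rewrite (sqr_sqrtr (b'0 _)) (sqr_sqrtr (ltW (b0 i.+1 ik))).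
elim=> [|i IH] ik.
  have aE : a 0 = a' 0 by have := eqa 1 ik; rewrite /= !div1r => /invr_inj.
  by split=> //; apply: eqb'.
have [aE bE] := IH (ltnW ik).
have aE' : a i.+1 = a' i.+1.
  by have := eqa i.+2 ik; rewrite /= aE bE !div1r => /addIr/invr_inj.
by split=> //; apply: eqb'.
Qed.

(** Here [rho] stands for stored squared norms and [nu] for those of the model. Each [b i.+1] is at
    least [1 - u] times a quotient of consecutive [rho], and these quotients telescope. *)
Lemma quotient_chain_le (R : realFieldType) (u : R) (rho b nu : nat -> R) j :
  0 <= u < 1 -> (forall i, 0 <= nu i) ->
  (forall i, (i <= j)%N -> 0 < rho i) ->
  (forall i, (i < j)%N -> `|b i.+1 - rho i.+1 / rho i| <= u * `|rho i.+1 / rho i|) ->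
  (forall i, (i < j)%N -> nu i.+1 = b i.+1 * nu i) ->
  (1 - u) ^+ j * rho j * nu 0 <= nu j * rho 0.
Proof.
move=> /andP[u0 u1] nu0; elim: j => [|j IH] rho0 berr nuS.
  by rewrite mul1r mulrC.
have {}IH := IH (fun i h => rho0 i (leqW h)) (fun i h => berr i (ltnW h))
  (fun i h => nuS i (ltnW h)).
have rj := rho0 j (leqnSn j); have rj1 := rho0 j.+1 (leqnn _).
have q0 : 0 < rho j.+1 / rho j by rewrite divr_gt0.
have bge : (1 - u) * (rho j.+1 / rho j) <= b j.+1.
  have := berr j (ltnSn j); rewrite (gtr0_norm q0) ler_distl => /andP[+ _].
  by rewrite mulrBl mul1r.
rewrite nuS // exprS.
have -> : (1 - u) * (1 - u) ^+ j * rho j.+1 * nu 0 =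
    (1 - u) * (rho j.+1 / rho j) * ((1 - u) ^+ j * rho j * nu 0).
  by field; rewrite gt_eqF.
apply: (@le_trans _ _ ((1 - u) * (rho j.+1 / rho j) * (nu j * rho 0))).
  by rewrite ler_wpM2l // mulr_ge0 ?subr_ge0 // ltW.
by rewrite -[leRHS]mulrA ler_wpM2r // mulr_ge0 // ltW // rho0.
Qed.

Lemma projection_residual (R : comNzRingType) (n m : nat) (A : 'M[R]_n)
    (V F : 'M[R]_(n, m.+1)) (T : 'M[R]_m.+1) (w r0 : 'cV[R]_n) (y : 'cV[R]_m.+1)
    (s t : R) :
  A *m V = V *m T + t *: (w *m delta_mx 0 ord_max) + F ->
  T *m y = s *: delta_mx ord0 0 ->
  r0 - A *m (V *m y) = (r0 - s *: col ord0 V) - (t * y ord_max 0) *: w - F *m y.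
Proof.
move=> AV Ty; rewrite mulmxA AV !mulmxDl -mulmxA Ty -scalemxAr -colE.
rewrite -scalemxAl -mulmxA -rowE [row ord_max y]mx11_scalar mxE mul_mx_scalar.
by rewrite scalerA !opprD !addrA.
Qed.

(** All facts about a model, for both methods at once: the rates, the initial norm, the squared-norm
    recursion used for CG and the last-residual formula used for Lanczos. *)
Lemma lanczos_model_cg (R : realType) (N k : nat) (M : 'M[R]_N) (v : 'cV[R]_N)
    (c lo hi : R) (al be : nat -> R) :
  0 < lo -> spectrum_in lo hi M -> c != 0 -> lanczos_model k M v al be ->
  let r := exact_cg_residual M (c *: v) in
  [/\ forall j, norm_in (invmx M) (r j) / norm_in (invmx M) (r 0) <=
        2 * ((Num.sqrt (hi / lo) - 1) / (Num.sqrt (hi / lo) + 1)) ^+ j /\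
        norm2 (r j) / norm2 (r 0) <= 2 * Num.sqrt (hi / lo) *
          ((Num.sqrt (hi / lo) - 1) / (Num.sqrt (hi / lo) + 1)) ^+ j,
      norm2 (r 0) = `|c|,
      forall a b : nat -> R, (forall i, (i < k)%N -> 0 < a i) ->
        (forall i, (1 <= i <= k)%N -> 0 < b i) ->
        al = jacobi_alpha a b -> be = jacobi_beta a b ->
        forall i, (i < k)%N -> norm2 (r i.+1) ^+ 2 = b i.+1 * norm2 (r i) ^+ 2 &
      forall m (T : 'M[R]_m.+1) (y : 'cV[R]_m.+1) (s : R), (m < k)%N ->
        (forall i l : 'I_m.+1, T i l =
          if (i == l :> nat) then al i.+1
          else if (l == i.+1 :> nat) then be l.+1
          else if (i == l.+1 :> nat) then be i.+1
          else 0) ->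
        s != 0 -> T *m y = s *: delta_mx ord0 0 ->
        norm2 (r m.+1) = `|c / s| * `|be m.+2 * y ord_max 0|].
Proof.
case: N M v => [|N] M v lo0 Mspec c0 [Msym v1 laE lbE lb0] r.
  (* Dimension zero has no unit vector. *)
  by move: v1; rewrite /norm2 dotE big_ord0 sqrtr0 => /esym/eqP; rewrite oner_eq0.
have Mpos := dot_mulmx_gt0 Msym Mspec lo0.
have v0 : v != 0 by rewrite -norm2_eq0 v1 oner_eq0.
have r_neq0 i : (i < k)%N -> cg_r (exact_arith R N.+1) M (c *: v) 0 i != 0.
  exact: exact_cg_r_neq0_lan.
split.
- by move=> j; apply: exact_cg_convergence => //; rewrite scaler_eq0 negb_or c0.
- by rewrite /r /exact_cg_residual exact_cg_r0 norm2Z v1 mulr1.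
- move=> a b a0 b0 alE bE i ik.
  (* Injectivity identifies the given coefficients with the exact CG coefficients of the model. *)
  have [||||_ ->] := @jacobi_inj R a b (cg_a (exact_arith R N.+1) M (c *: v) 0)
    (cg_b (exact_arith R N.+1) M (c *: v) 0) k a0 b0 _ _ _ _ i ik.
  + by move=> l /r_neq0; apply: exact_cg_a_gt0.
  + by move=> [|l] //; rewrite exact_cg_bE divr_ge0 ?dot_ge0.
  + move=> [|l] // lk; rewrite -alE -laE //.
    by case: (exact_lan_cg Msym Mpos v1 c0 (r_neq0 l lk)).
  + move=> [|[|l]] // lk; rewrite -bE -lbE //.
    by case: (exact_lan_cg Msym Mpos v1 c0 (r_neq0 l lk)).
  by rewrite exact_cg_bE -!sqr_norm2 divfK // sqrf_eq0 norm2_eq0 r_neq0.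
move=> m T y s mk TE s0 Ty.
rewrite -(lbE m.+2) //; apply: exact_lan_residual => //; first exact: r_neq0.
rewrite -Ty; congr (_ *m _); apply/matrixP => i l; rewrite TE mxE.
have [il|_] := eqVneq (i : nat) l.
  by rewrite laE //; exact: leq_trans (ltn_ord i) mk.
have [li|_] := eqVneq (l : nat) i.+1.
  by rewrite lbE // li; have := ltn_ord l; lia.
by have [il|_] //:= eqVneq (i : nat) l.+1; rewrite lbE // il; have := ltn_ord i; lia.
Qed.

(** [x], [x0] are stored residual norms and [y], [y0] model norms. After squaring, the factors
    [1 - g] and [1 + g] pass from stored norms to [rho], and the telescoped chain passes on to the
    model. *)
Lemma stored_ratio_le (R : rcfType) (g u x x0 y y0 rho rho0 : R) (j : nat) :
  0 <= g < 1 -> 0 <= u < 1 -> 0 <= x -> 0 < x0 -> 0 <= y -> 0 < y0 ->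
  (1 - g) * x ^+ 2 <= rho -> rho0 <= (1 + g) * x0 ^+ 2 ->
  (1 - u) ^+ j * rho * y0 ^+ 2 <= y ^+ 2 * rho0 ->
  x / x0 <= Num.sqrt ((1 + g) / (1 - g)) * Num.sqrt (1 - u) ^- j * (y / y0).
Proof.
move=> /andP[g0 g1] /andP[u0 u1] x_ge0 x0_gt0 y_ge0 y0_gt0 xrho rhox0 chain.
have g1' : 0 < 1 - g by rewrite subr_gt0.
have u1' : 0 < 1 - u by rewrite subr_gt0.
have uj : 0 < (1 - u) ^+ j by rewrite exprn_gt0.
have G0 : 0 <= (1 + g) / (1 - g) by apply: divr_ge0; lra.
rewrite -(@ler_pXn2r _ 2) ?nnegrE //; first last.
- by rewrite !mulr_ge0 ?sqrtr_ge0 ?invr_ge0 ?exprn_ge0 ?sqrtr_ge0 // ltW.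
- by rewrite divr_ge0 // ltW.
have -> : (Num.sqrt ((1 + g) / (1 - g)) * Num.sqrt (1 - u) ^- j * (y / y0)) ^+ 2 =
    (1 + g) * y ^+ 2 / ((1 - g) * (1 - u) ^+ j * y0 ^+ 2).
  rewrite !exprMn sqr_sqrtr // exprVn -exprM mulnC exprM sqr_sqrtr ?(ltW u1') //.
  by rewrite exprVn; field; rewrite !gt_eqF.
rewrite exprMn exprVn ler_pdivrMr ?exprn_gt0 // mulrAC ler_pdivlMr; last first.
  by rewrite !mulr_gt0 // exprn_gt0.
have -> : x ^+ 2 * ((1 - g) * (1 - u) ^+ j * y0 ^+ 2) =
    (1 - u) ^+ j * ((1 - g) * x ^+ 2) * y0 ^+ 2 by ring.
apply: (@le_trans _ _ ((1 - u) ^+ j * rho * y0 ^+ 2)).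
  by rewrite ler_wpM2r ?sqr_ge0 // ler_wpM2l // ltW.
apply: (le_trans chain).
have -> : (1 + g) * y ^+ 2 * x0 ^+ 2 = y ^+ 2 * ((1 + g) * x0 ^+ 2) by ring.
by rewrite ler_wpM2l ?sqr_ge0.
Qed.

(** The factor of exponent [- j / 2] is written [Num.sqrt (1 - u) ^- j]. The scalar [c l] is the
    free multiple of the first Lanczos vector; prescribing the initial Lanczos norm fixes [c Lan] up
    to sign. *)
Theorem proposition4 (R : realType) (n : nat) (A : 'M[R]_n) (delta : R)
    (K : arith R n) (b x0 : 'cV[R]_n) (k : nat)
    (N : method -> nat) (Ahat : forall l, 'M[R]_(N l))
    (vhat : forall l, 'cV[R]_(N l)) (c : method -> R) :
  let a_ := lambda_min A - delta in
  let b_ := lambda_max A + delta in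
  let kappa := b_ / a_ in
  let q_ := (Num.sqrt kappa - 1) / (Num.sqrt kappa + 1) in
  let rhat l j := exact_cg_residual (Ahat l) (c l *: vhat l) j in
  sym_posdef A ->
  0 <= delta < lambda_min A ->
  (forall j, (j < k)%N -> 0 < cg_a K A b x0 j) ->
  (forall j, (1 <= j <= k)%N -> 0 < cg_b K A b x0 j) ->
  (forall l, lanczos_model k (Ahat l) (vhat l)
               (tridiag_alpha K A b x0 l) (tridiag_beta K A b x0 l)) ->
  (forall l, spectrum_in a_ b_ (Ahat l)) ->
  (forall l, c l != 0) ->
  [/\ (* exact CG on either model *)
      forall l j, (j <= k)%N ->
        norm_in (invmx (Ahat l)) (rhat l j) /
          norm_in (invmx (Ahat l)) (rhat l 0%N) <= 2 * q_ ^+ j /\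
        norm2 (rhat l j) / norm2 (rhat l 0%N) <= 2 * Num.sqrt kappa * q_ ^+ j,
      (* stored CG residuals *)
      forall (u : R) (rho : nat -> R) (j : nat), (j <= k)%N ->
        0 <= u < 1 -> gamma n u < 1 ->
        cg_no_breakdown K A b x0 j ->
        cg_sqnorm_reused K A b x0 rho j ->
        cg_sqnorm_accurate K A b x0 (gamma n u) rho j ->
        cg_div_accurate K A b x0 u j ->
        norm2 (cg_r K A b x0 j) / norm2 (cg_r K A b x0 0) <=
          Num.sqrt ((1 + gamma n u) / (1 - gamma n u)) *
          Num.sqrt (1 - u) ^- j *
          (norm2 (rhat Cg j) / norm2 (rhat Cg 0%N)) &
      (* direct Lanczos at step j = m + 1, e_j being the last coordinate vector *)
      forall (m : nat) (F : 'M[R]_(n, m.+1)) (y : 'cV[R]_m.+1), (m < k)%N ->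
        let j := m.+1 in
        let v := lan_v K A b x0 in
        let beta := lan_beta K A b x0 in
        let V := lan_V K A b x0 j in
        let T := lan_T K A b x0 j in
        let x := x0 + V *m y in
        let r0true := b - A *m x0 in
        A *m V = V *m T + beta j.+1 *: (v j.+1 *m delta_mx 0 ord_max) + F ->
        0 < beta 1%N ->
        T *m y = beta 1%N *: delta_mx ord0 0 ->
        b - A *m x = (r0true - beta 1%N *: v 1%N)
                     - (beta j.+1 * y ord_max 0) *: v j.+1 - F *m y /\
        (norm2 (rhat Lan 0%N) = beta 1%N ->
         norm2 (b - A *m x) <=
           norm2 (r0true - beta 1%N *: v 1%N)
           + norm2 (v j.+1) * norm2 (rhat Lan j) + norm2 (F *m y))].
Proof.
move=> a_ b_ kappa q_ rhat _ /andP[_ delta_lt] cga0 cgb0 models spec c0.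
have lo0 : 0 < a_ by rewrite subr_gt0.
have models' l := lanczos_model_cg lo0 (spec l) (c0 l) (models l).
split.
- by move=> l j _; case: (models' l) => /(_ j).
- move=> u rho j jk u01 g1 [r_neq0 _] reused acc divacc.
  have [_ n0 nuS _] := models' Cg.
  have {}nuS := nuS _ _ cga0 cgb0 erefl erefl.
  have rhoE i : (i <= j)%N ->
      (1 - gamma n u) * norm2 (cg_r K A b x0 i) ^+ 2 <= rho i <=
      (1 + gamma n u) * norm2 (cg_r K A b x0 i) ^+ 2.
    move=> /acc; rewrite /rel_err -sqr_norm2 [X in _ * X]ger0_norm ?sqr_ge0 //.
    by rewrite ler_distl mulrBl mulrDl !mul1r.
  (* [gamma n u] is negative when [n u > 1]; the error bound at [r_0 != 0] excludes
     this. *)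
  have g0 : 0 <= gamma n u.
    have x0_gt0 : 0 < norm2 (cg_r K A b x0 0) ^+ 2.
      by rewrite exprn_gt0 // norm2_gt0 r_neq0.
    have /andP[h1 h2] := rhoE 0 (leq0n j).
    have := le_trans h1 h2; rewrite ler_pM2r //; lra.
  have /andP[hj _] := rhoE j (leqnn j); have /andP[_ h0] := rhoE 0 (leq0n j).
  apply: (stored_ratio_le _ _ _ _ _ _ hj h0); rewrite ?g0 ?norm2_ge0 //.
  + by rewrite norm2_gt0 r_neq0.
  + by rewrite [norm2 _]n0 normr_gt0.
  apply: (quotient_chain_le (b := cg_b K A b x0)
            (nu := fun i => norm2 (rhat Cg i) ^+ 2)) => //.
  + by move=> i; rewrite sqr_ge0.
  + move=> i ij; have /andP[+ _] := rhoE i ij; apply: lt_le_trans.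
    by rewrite mulr_gt0 ?subr_gt0 // exprn_gt0 // norm2_gt0 r_neq0.
  + by move=> i ij; have [_] := divacc i ij; have [_ -> ->] := reused i ij.
  + by move=> i ij; apply: nuS; exact: leq_trans jk.
move=> m F y mk j v beta V T x r0true AV beta0 Ty.
have resE : b - A *m x = (r0true - beta 1%N *: v 1%N)
                     - (beta j.+1 * y ord_max 0) *: v j.+1 - F *m y.
  rewrite mulmxDr opprD addrA (projection_residual _ AV Ty); congr (_ - _ *: _ - _ - _).
  by apply/colP => i; rewrite !mxE.
split=> // n0; rewrite resE.
apply: le_trans (norm2B _ _) _; rewrite lerD2r.
apply: le_trans (norm2B _ _) _; rewrite lerD2l norm2Z mulrC ler_wpM2l ?norm2_ge0 //.
have [_ c_abs _ /(_ m T y (beta 1%N) mk)] := models' Lan.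
(* The prescribed initial norm turns the prefactor of the model residual formula into 1. *)
have cb : `|c Lan / beta 1%N| = 1.
  by rewrite normf_div (gtr0_norm beta0) -c_abs [norm2 _]n0 mulfV // gt_eqF.
move=> -> //; first by rewrite cb mul1r.
  by move=> i l; rewrite mxE.
by rewrite gt_eqF.
Qed.
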